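(* For every $\alpha\in\mathbb C\setminus\mathbb Z$, the system $\{\sin(2n+\alpha)x\}_{n\in\mathbb Z}$ is a Riesz basis in $L_2(0,\pi)$.
   Context: $L_2(0,\pi)$ is the complex Hilbert space of square-integrable complex-valued functions. *)

(* Defs.v *)
From HB Require Import structures.
From mathcomp Require Import all_boot all_order all_algebra ring lra.
From mathcomp Require Import complex ring_quotient.
From mathcomp Require Import all_classical all_reals all_analysis.
From mathcomp Require Import measurable_realfun.

Set Implicit Arguments.
Unset Strict Implicit.
Unset Printing Implicit Defensive.

Import Order.TTheory GRing.Theory Num.Theory.
Import numFieldNormedType.Exports.

Local Open Scope classical_set_scope.
Local Open Scope ring_scope.

(* In this file [Re] and [Im] are the projections of [R[i]], and [z%:C] is the
   embedding of [R] in [R[i]]. *)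
Notation Re := (@complex.Re _).
Notation Im := (@complex.Im _).
Notation normc := ComplexField.Normc.normc.
Notation "x %:C" := (real_complex _ x) (format "x %:C") : ring_scope.

Section ComplexSine.
Context {R : realType}.
Implicit Types z : R[i].

Definition cexp z : R[i] :=
  Complex (expR (Re z) * cos (Im z)) (expR (Re z) * sin (Im z)).

Definition csin z : R[i] :=
  (cexp ('i%C * z) - cexp (- ('i%C * z))) / (2 * 'i%C).

Lemma csinE z :
  csin z = Complex ((expR (Im z) + expR (- Im z)) / 2 * sin (Re z))
                   ((expR (Im z) - expR (- Im z)) / 2 * cos (Re z)).
Proof.
rewrite /csin; have i0 : 2 * 'i%C != 0 :> R[i].
  by rewrite mulf_neq0 ?pnatr_eq0// eq_complex /= oner_eq0 andbF.
apply: (mulIf i0); rewrite divfK//.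
have -> : 2 = Complex 2 0 :> R[i] by rewrite -[2]/(1 + 1); simpc.
case: z => u v /=; rewrite /cexp; simpc => /=.
by rewrite cosN sinN; congr Complex; field.
Qed.

End ComplexSine.

Section RieszBasis.
Context {R : realType} {V : lmodType R[i]}.
Variable dot : {dot V for Num.conj}.

Definition hnorm (v : V) : R := Num.sqrt (Re (dot v v)).

(* Completeness of the system is density of its linear span. *)
Definition orthonormal_basis (I : eqType) (e : I -> V) : Prop :=
  (forall i j, dot (e i) (e j) = (i == j)%:R) /\
  (forall v (eps : R), 0 < eps ->
     exists (s : seq I) (c : I -> R[i]),
       hnorm (v - \sum_(i <- s) c i *: e i) < eps).

Definition bounded_operator (T : V -> V) : Prop :=
  exists M : R, forall v, hnorm (T v) <= M * hnorm v.

(* A Riesz basis is the image of an orthonormal basis under a bounded linear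
   operator with bounded inverse. *)
Definition riesz_basis (I : eqType) (f : I -> V) : Prop :=
  exists2 e : I -> V, orthonormal_basis e &
  exists T S : {linear V -> V},
    [/\ bounded_operator T, bounded_operator S,
        cancel T S, cancel S T & forall i, T (e i) = f i].

End RieszBasis.

Section L2.
Context {R : realType}.
Variables a b : R.
Let mu : {measure set measurableTypeR R -> \bar R} := lebesgue_measure.
Let D : set R := `]a, b[%classic.

Definition square_integrable (f : R -> R[i]) : Prop :=
  [/\ measurable_fun D (Re \o f), measurable_fun D (Im \o f) &
      mu.-integrable D (fun x => (normc (f x) ^+ 2)%:E)].

Definition sqint : {pred R -> R[i]} := mem [set f | square_integrable f].

Let mD : measurable D. Proof. exact: measurable_itv. Qed.

Lemma normc2 (z : R[i]) : normc z ^+ 2 = Re z ^+ 2 + Im z ^+ 2.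
Proof. by case: z => x y /=; rewrite sqr_sqrtr// addr_ge0// sqr_ge0. Qed.

Lemma ReD (z w : R[i]) : Re (z + w) = Re z + Re w.
Proof. by case: z w => ? ? []. Qed.
Lemma ImD (z w : R[i]) : Im (z + w) = Im z + Im w.
Proof. by case: z w => ? ? []. Qed.
Lemma ReM (z w : R[i]) : Re (z * w) = Re z * Re w - Im z * Im w.
Proof. by case: z w => ? ? []. Qed.
Lemma ImM (z w : R[i]) : Im (z * w) = Re z * Im w + Im z * Re w.
Proof. by case: z w => ? ? []. Qed.

Lemma sqint_submod_closed : submod_closed sqint.
Proof.
split.
  rewrite inE /=; split; try exact: measurable_cst.
  under eq_fun do rewrite normc2 /= expr0n addr0.
  exact: integrable0.
move=> c f g /[!inE] -[rf jf nf] [rg jg ng].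
have rh : measurable_fun D (Re \o (c *: f + g)).
  rewrite (_ : _ \o _ = fun x => (Re c * Re (f x) - Im c * Im (f x)) + Re (g x)).
    apply: measurable_funD => //; apply: measurable_funB;
      by apply: measurable_funM => //; exact: measurable_cst.
  by apply/funext => x /=; rewrite ReD ReM.
have jh : measurable_fun D (Im \o (c *: f + g)).
  rewrite (_ : _ \o _ = fun x => (Re c * Im (f x) + Im c * Re (f x)) + Im (g x)).
    apply: measurable_funD => //; apply: measurable_funD;
      by apply: measurable_funM => //; exact: measurable_cst.
  by apply/funext => x /=; rewrite ImD ImM.
split => //.
apply: (@le_integrable _ _ _ mu D mD _ (fun x =>
  ((2 * normc c ^+ 2)%:E * (normc (f x) ^+ 2)%:E
   + 2%:E * (normc (g x) ^+ 2)%:E)%E)).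
- apply/measurable_EFinP; under eq_fun do rewrite normc2.
  by apply: measurable_funD; exact: measurable_funX.
- move=> x _; rewrite -!EFinM -EFinD !abse_EFin lee_fin.
  rewrite !ger0_norm ?sqr_ge0//; last first.
    by rewrite addr_ge0// mulr_ge0 ?sqr_ge0// mulr_ge0// sqr_ge0.
  rewrite [(c *: f + g) x]/(c * f x + g x) !normc2 !ReD !ImD !ReM !ImM.
  set p := Re c; set q := Im c; set r := Re (f x); set s := Im (f x).
  set t := Re (g x); set u := Im (g x).
  have := sqr_ge0 (p * r - q * s - t).
  have := sqr_ge0 (p * s + q * r - u).
  nra.
- by apply: integrableD => //; exact: integrableZl.
Qed.

HB.instance Definition _ :=
  GRing.isSubmodClosed.Build _ _ sqint sqint_submod_closed.

Record sqfun := SqFun { sqfun_val :> R -> R[i]; _ : sqfun_val \in sqint }.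

HB.instance Definition _ := [isSub for sqfun_val].
HB.instance Definition _ := [Choice of sqfun by <:].
HB.instance Definition _ := [SubChoice_isSubLmodule of sqfun by <:].

Lemma sqfunP (f : sqfun) : square_integrable f.
Proof. by have := valP f; rewrite inE. Qed.

Definition ae_zero : {pred sqfun} :=
  mem [set f : sqfun | {ae mu, forall x, D x -> f x = 0}].

Lemma ae_zero_submod_closed : submod_closed ae_zero.
Proof.
split; first by rewrite inE /=; apply: nearW => x.
move=> c f g /[!inE] /= f0 g0.
have F := ae_filter_ringOfSetsType mu.
apply: filterS2 f0 g0 => x f0 g0 Dx; change ((c : R[i]) * f x + g x = 0).
by rewrite f0// g0// mulr0 addr0.
Qed.

HB.instance Definition _ :=
  GRing.isSubmodClosed.Build _ _ ae_zero ae_zero_submod_closed.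

(* Classes of square-integrable functions modulo equality almost everywhere on
   the interval. *)
Definition L2 : Type := Quotient.quot ae_zero.

HB.instance Definition _ := GRing.Zmodule.on L2.
HB.instance Definition _ : EqQuotient _ (Quotient.equiv ae_zero) L2 :=
  EqQuotient.on L2.
HB.instance Definition _ := ZmodQuotient.on L2.

Definition L2_class : sqfun -> L2 := \pi_L2%qT.

Lemma L2_classP (f g : sqfun) :
  L2_class f = L2_class g <-> {ae mu, forall x, D x -> f x = g x}.
Proof.
have F := ae_filter_ringOfSetsType mu.
rewrite /L2_class; split.
  move/eqP; rewrite -Quotient.idealrBE inE /=.
  by apply: filterS => x h Dx; apply/eqP; rewrite -subr_eq0; apply/eqP/h.
move=> h; apply/eqP; rewrite -Quotient.idealrBE inE /=.
by apply: filterS h => x h Dx; change (f x - g x = 0); rewrite h// subrr.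
Qed.

Lemma L2_ind (P : L2 -> Prop) : (forall f, P (L2_class f)) -> forall u, P u.
Proof. by move=> h u; rewrite -[u]reprK; exact: h. Qed.

Lemma L2_classD : {morph L2_class : f g / f + g}.
Proof. by move=> f g; rewrite /L2_class !piE. Qed.

Lemma L2_repr (f : sqfun) :
  {ae mu, forall x, D x -> repr (L2_class f) x = f x}.
Proof. by apply/L2_classP; rewrite {1}/L2_class reprK. Qed.

Definition L2_scale (c : R[i]) (u : L2) : L2 := L2_class (c *: repr u).

Let L2_scale_class c (f : sqfun) : L2_scale c (L2_class f) = L2_class (c *: f).
Proof.
have F := ae_filter_ringOfSetsType mu.
apply/L2_classP; apply: filterS (L2_repr f) => x h Dx.
by change (c * repr (L2_class f) x = c * f x); rewrite h.
Qed.

Let L2_scalerA c d u : L2_scale c (L2_scale d u) = L2_scale (c * d) u.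
Proof.
by elim/L2_ind: u => f; rewrite !L2_scale_class scalerA.
Qed.

Let L2_scale1r : left_id 1 L2_scale.
Proof. by elim/L2_ind => f; rewrite L2_scale_class scale1r. Qed.

Let L2_scalerDr : right_distributive L2_scale +%R.
Proof.
move=> c; elim/L2_ind => f; elim/L2_ind => g.
by rewrite -L2_classD !L2_scale_class -L2_classD scalerDr.
Qed.

Let L2_scalerDl u : {morph L2_scale^~ u : c d / c + d}.
Proof.
move=> c d; elim/L2_ind: u => f.
by rewrite !L2_scale_class -L2_classD scalerDl.
Qed.

HB.instance Definition _ := GRing.Zmodule_isLmodule.Build R[i] L2
  L2_scalerA L2_scale1r L2_scalerDr L2_scalerDl.

Lemma L2_classZ c f : L2_class (c *: f) = c *: L2_class f.
Proof. by rewrite -L2_scale_class. Qed.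

Definition cintegrable (h : R -> R[i]) : Prop :=
  mu.-integrable D (EFin \o (Re \o h)) /\
  mu.-integrable D (EFin \o (Im \o h)).

Definition cintegral (h : R -> R[i]) : R[i] :=
  Complex (\int[mu]_(x in D) Re (h x)) (\int[mu]_(x in D) Im (h x)).

Lemma cintegralD h k : cintegrable h -> cintegrable k ->
  cintegral (fun x => h x + k x) = cintegral h + cintegral k.
Proof.
move=> [rh jh] [rk jk]; rewrite /cintegral; simpc; congr Complex.
  by rewrite -RintegralD//; apply: eq_Rintegral => x _; rewrite ReD.
by rewrite -RintegralD//; apply: eq_Rintegral => x _; rewrite ImD.
Qed.

Lemma cintegralZ c h : cintegrable h ->
  cintegral (fun x => c * h x) = c * cintegral h.
Proof.
move=> [rh jh].
have rz k : mu.-integrable D (EFin \o (fun x => k * Re (h x))).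
  exact: (@integrableZl _ _ _ mu D mD k _ rh).
have jz k : mu.-integrable D (EFin \o (fun x => k * Im (h x))).
  exact: (@integrableZl _ _ _ mu D mD k _ jh).
case: c => p q; rewrite /cintegral; simpc; congr Complex.
  rewrite -!RintegralZl// -RintegralB//.
  by apply: eq_Rintegral => x _; rewrite ReM.
rewrite -!RintegralZl// -RintegralD//.
by apply: eq_Rintegral => x _; rewrite ImM.
Qed.

Lemma cintegral_conj h : cintegrable h ->
  cintegral (fun x => (h x)^*) = (cintegral h)^*.
Proof.
move=> [rh jh]; rewrite -[RHS]/(conjc (cintegral h)) /cintegral /=.
congr Complex.
  by apply: eq_Rintegral => x _; case: (h x).
rewrite -mulN1r -RintegralZl//.
by apply: eq_Rintegral => x _; rewrite mulN1r; case: (h x).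
Qed.

Lemma sqfun_cintegrable (f g : sqfun) :
  cintegrable (fun x => f x * (g x)^*).
Proof.
have [rf jf nf] := sqfunP f; have [rg jg ng] := sqfunP g.
have rE : Re \o (fun x => f x * (g x)^*) =
          (fun x => Re (f x) * Re (g x) + Im (f x) * Im (g x)).
  by apply/funext => x /=; case: (f x) (g x) => ? ? [? ?] /=; rewrite mulrN opprK.
have jE : Im \o (fun x => f x * (g x)^*) =
          (fun x => Im (f x) * Re (g x) - Re (f x) * Im (g x)).
  by apply/funext => x /=; case: (f x) (g x) => ? ? [? ?] /=; rewrite mulrN addrC.
have nfg : mu.-integrable D
    (fun x => ((normc (f x) ^+ 2)%:E + (normc (g x) ^+ 2)%:E)%E).
  exact: integrableD.
split; [rewrite rE|rewrite jE]; apply: le_integrable nfg => //.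
- apply/measurable_EFinP; apply: measurable_funD; exact: measurable_funM.
- move=> x _; rewrite /= lee_fin !normc2 [leRHS]ger0_norm; last first.
    by rewrite !addr_ge0// sqr_ge0.
  rewrite ler_norml.
  set r := Re (f x); set s := Im (f x); set t := Re (g x); set u := Im (g x).
  have := sqr_ge0 (r + t); have := sqr_ge0 (s + u).
  have := sqr_ge0 (r - t); have := sqr_ge0 (s - u).
  by have := sqr_ge0 r; have := sqr_ge0 s; have := sqr_ge0 t;
     have := sqr_ge0 u; nra.
- apply/measurable_EFinP; apply: measurable_funB; exact: measurable_funM.
- move=> x _; rewrite /= lee_fin !normc2 [leRHS]ger0_norm; last first.
    by rewrite !addr_ge0// sqr_ge0.
  rewrite ler_norml.
  set r := Re (f x); set s := Im (f x); set t := Re (g x); set u := Im (g x).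
  have := sqr_ge0 (s + t); have := sqr_ge0 (r + u).
  have := sqr_ge0 (s - t); have := sqr_ge0 (r - u).
  by have := sqr_ge0 r; have := sqr_ge0 s; have := sqr_ge0 t;
     have := sqr_ge0 u; nra.
Qed.

Definition L2_dot (u v : L2) : R[i] :=
  cintegral (fun x => repr u x * (repr v x)^*).

Lemma L2_dot_class (f g : sqfun) :
  L2_dot (L2_class f) (L2_class g) = cintegral (fun x => f x * (g x)^*).
Proof.
have F := ae_filter_ringOfSetsType mu.
have [[r1 i1] [r2 i2]] := (sqfun_cintegrable f g,
  sqfun_cintegrable (repr (L2_class f)) (repr (L2_class g))).
rewrite /L2_dot /cintegral; congr Complex; congr fine; apply: ae_eq_integral => //;
  do ?[exact: measurable_int r1|exact: measurable_int r2
      |exact: measurable_int i1|exact: measurable_int i2].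
- by apply: filterS2 (L2_repr f) (L2_repr g) => x hf hg Dx; rewrite hf// hg.
- by apply: filterS2 (L2_repr f) (L2_repr g) => x hf hg Dx; rewrite hf// hg.
Qed.

Lemma L2_dotC u v : L2_dot u v = (L2_dot v u)^*.
Proof.
elim/L2_ind: u => f; elim/L2_ind: v => g; rewrite !L2_dot_class.
rewrite -cintegral_conj; last exact: sqfun_cintegrable.
by congr cintegral; apply/funext => x; rewrite rmorphM [X in _ = _ * X]conjCK mulrC.
Qed.

Let L2_dot_linearl w : linear_for *%R (L2_dot ^~ w).
Proof.
move=> c; elim/L2_ind => f; elim/L2_ind => g; elim/L2_ind: w => h.
rewrite -L2_classZ -L2_classD !L2_dot_class.
have fh := sqfun_cintegrable f h; have gh := sqfun_cintegrable g h.
have cfh : cintegrable (fun x => c * (f x * (h x)^*)).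
  have := sqfun_cintegrable (c *: f) h; congr cintegrable.
  by apply/funext => x; rewrite mulrA.
rewrite -cintegralZ// -cintegralD//; congr cintegral; apply/funext => x.
by change ((c * f x + g x) * (h x)^* = c * (f x * (h x)^*) + g x * (h x)^*);
   rewrite mulrDl mulrA.
Qed.

Let L2_dot_bilinear : bilinear_for *%R (Num.conj \; *%R) L2_dot.
Proof.
split=> [w|w]; first exact: L2_dot_linearl.
move=> c u v; rewrite L2_dotC L2_dot_linearl rmorphD rmorphM /=.
by rewrite -!L2_dotC.
Qed.

HB.instance Definition _ :=
  bilinear_isBilinear.Build R[i] L2 L2 R[i] *%R (Num.conj \; *%R) L2_dot
    L2_dot_bilinear.

Let L2_dot_hermitian u v : L2_dot u v = (-1) ^+ false * (L2_dot v u)^*.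
Proof. by rewrite expr0 mul1r -L2_dotC. Qed.

HB.instance Definition _ :=
  isHermitianSesquilinear.Build R[i] L2 false Num.conj L2_dot L2_dot_hermitian.

Lemma L2_dot_self (f : sqfun) : L2_dot (L2_class f) (L2_class f) =
  (\int[mu]_(x in D) (normc (f x) ^+ 2))%:C.
Proof.
rewrite L2_dot_class /cintegral; congr Complex.
  apply: eq_Rintegral => x _; rewrite normc2.
  by case: (f x) => p q /=; rewrite mulrN opprK.
rewrite (_ : (fun x => _) = cst 0) ?Rintegral_cst ?mul0r//.
apply/funext => x; case: (f x) => p q /=.
by rewrite mulrN mulrC addNr.
Qed.

Let L2_dot_gt0 u : u != 0 -> 0 < L2_dot u u.
Proof.
have F := ae_filter_ringOfSetsType mu.
elim/L2_ind: u => f f0; rewrite L2_dot_self ltcR /Rintegral.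
have [rf jf nf] := sqfunP f.
have i0 : (0 <= \int[mu]_(x in D) (normc (f x) ^+ 2)%:E)%E.
  by apply: integral_ge0 => x _; rewrite lee_fin sqr_ge0.
rewrite fine_gt0//; apply/andP; split; last first.
  exact: integrable_lty nf.
rewrite lt_neqAle i0 andbT; apply: contra f0 => /eqP fi.
have : (\int[mu]_(x in D) `|(normc (f x) ^+ 2)%:E| = 0)%E.
  by rewrite [RHS]fi; apply: eq_integral => x _; rewrite gee0_abs// lee_fin sqr_ge0.
move=> /(ae_eq_integral_abs mu mD (measurable_int _ nf)) f_ae0.
apply/eqP; rewrite (_ : 0 = L2_class 0); last by rewrite /L2_class piE.
apply/L2_classP; apply: filterS f_ae0 => x h Dx.
have [/eqP] := h Dx; rewrite sqrf_eq0 => /eqP.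
exact: ComplexField.Normc.eq0_normc.
Qed.

HB.instance Definition _ := isDotProduct.Build R[i] L2 L2_dot L2_dot_gt0.

Lemma continuous_sqint (f : R -> R[i]) :
  continuous (Re \o f : R -> R^o) -> continuous (Im \o f : R -> R^o) ->
  f \in sqint.
Proof.
move=> rf jf; rewrite inE /=; split.
- by apply: measurable_funTS; apply: continuous_measurable_fun.
- by apply: measurable_funTS; apply: continuous_measurable_fun.
- apply: (@integrableS _ _ _ mu `[a, b]%classic) => //.
    by move=> x; rewrite /= !in_itv /= => /andP[/ltW -> /ltW ->].
  apply: continuous_compact_integrable; first exact: segment_compact.
  apply: continuous_subspaceT => x; under eq_fun do rewrite normc2.
  by apply: cvgD; apply: continuous_comp (@exprn_continuous _ 2 _); [exact: rf|exact: jf].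
Qed.

End L2.

Section SineSystem.
Context {R : realType}.
Implicit Types (z : R[i]) (x : R).

Definition csin_fun z : R -> R[i] := fun x => csin (z * x%:C).

Lemma csin_fun_sqint (a b : R) z : csin_fun z \in sqint a b.
Proof.
have E x : csin_fun z x =
    Complex ((expR (Im z * x) + expR (- (Im z * x))) / 2 * sin (Re z * x))
            ((expR (Im z * x) - expR (- (Im z * x))) / 2 * cos (Re z * x)).
  by rewrite /csin_fun csinE ReM ImM /= !mulr0 subr0 add0r.
have cM p : continuous (fun x => p * x : R^o).
  by move=> x; apply: cvgM; [exact: cvg_cst|exact: cvg_id].
have ce p : continuous (fun x => expR (p * x) : R^o).
  by move=> x; apply: (continuous_comp (f := fun x : R => p * x : R) (g := expR)); [exact: cM|exact: continuous_expR].
have ceN p : continuous (fun x => expR (- (p * x)) : R^o).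
  by move=> x; under eq_fun do rewrite -mulNr; exact: ce.
apply: continuous_sqint => /=; rewrite /comp; under eq_fun do rewrite E;
  move=> x /=.
- apply: cvgM.
    by apply: cvgM; [apply: cvgD; [exact: ce|exact: ceN]|exact: cvg_cst].
  by apply: (continuous_comp (f := fun x : R => Re z * x : R) (g := sin)); [exact: cM|exact: continuous_sin].
- apply: cvgM.
    by apply: cvgM; [apply: cvgB; [exact: ce|exact: ceN]|exact: cvg_cst].
  by apply: (continuous_comp (f := fun x : R => Re z * x : R) (g := cos)); [exact: cM|exact: continuous_cos].
Qed.

Definition sin_L2 (a b : R) z : L2 a b := L2_class (SqFun (csin_fun_sqint a b z)).

End SineSystem.

(* Main.v *)
From HB Require Import structures.
Require Import Defs.
From mathcomp Require Import all_boot all_order all_algebra ring lra.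
From mathcomp Require Import complex measurable_realfun.
From mathcomp Require Import all_classical all_reals all_analysis.

(**
With [e_n(x) = exp(2inx) / sqrt pi], the operator
  [(T f)(x) = sqrt pi / (2i) * (exp(i alpha x) f(x) - exp(-i alpha x) f(pi - x))]
maps [e_n] to [sin((2n + alpha)x)], because [e_n(pi - x) = e_{-n}(x)]. It couples
only the values at [x] and [pi - x], so it is inverted by solving a 2x2 linear
system whose determinant is a nonzero constant times [sin(pi alpha)]; this does
not vanish as [alpha] is not an integer, and the inverse is again a bounded
operator of the same form.

It remains to see that [e_n] is complete. If [p] takes its values in [[0, 1]],
then [(1 - p^n)^(2^n)] tends to [1] where [p < 1/2] and to [0] where [p > 1/2]
(Bernoulli's inequality). For the trigonometric polynomial
[p(x) = (1 + sin x sin(x - c)) / 2] this puts the indicators of all rays in the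
closed span, by dominated convergence. A Dynkin class argument gives the
indicators of all Borel sets, and approximation by simple functions gives the
rest.
*)

Set Implicit Arguments.
Unset Strict Implicit.
Unset Printing Implicit Defensive.

Import Order.TTheory GRing.Theory Num.Theory.
Import numFieldNormedType.Exports.
(* Restores [Re] and [Im] of [Defs], which the imports above shadow. *)
Import Defs.

Local Open Scope classical_set_scope.
Local Open Scope ring_scope.

Lemma normc_ge0 {R : realType} (z : R[i]) : 0 <= normc z.
Proof. by case: z => x y /=; exact: sqrtr_ge0. Qed.

(** * Closed linear spans in a complex inner product space *)

Section ClosedSpan.
Context {R : realType} {V : lmodType R[i]} (dot : {dot V for Num.conj}).
Implicit Types u v w : V.
Local Notation hnorm := (hnorm dot).

Lemma hnorm_ge0 v : 0 <= hnorm v. Proof. exact: sqrtr_ge0. Qed.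

Lemma dot_self v : dot v v = (hnorm v ^+ 2)%:C.
Proof.
have := dnorm_ge0 dot v; rewrite lecE /= => /andP[/eqP im0 re0].
by rewrite /hnorm sqr_sqrtr//; case: (dot v v) im0 => x y /= ->.
Qed.

Lemma hnorm_sqr v : hnorm v ^+ 2 = Re (dot v v).
Proof. by rewrite dot_self. Qed.

Lemma hnorm0 : hnorm 0 = 0.
Proof. by rewrite /hnorm linear0r /= sqrtr0. Qed.

Lemma hnormZ c v : hnorm (c *: v) = normc c * hnorm v.
Proof.
apply/eqP; rewrite -(@eqrXn2 _ 2)//; first last.
- by rewrite mulr_ge0 ?hnorm_ge0// normc_ge0.
- exact: hnorm_ge0.
rewrite hnorm_sqr dnormZ dot_self exprMn.
have -> : `|c| = (normc c)%:C by [].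
by rewrite -rmorphXn -rmorphM.
Qed.

(** The parallelogram law gives [hnorm (u + v) ^+ 2 <= 2 * hnorm u ^+ 2 + 2 * hnorm v ^+ 2 < 4 * eps
    ^+ 2]. This serves as the triangle inequality throughout. *)
Lemma hnormD_lt u v eps : hnorm u < eps -> hnorm v < eps ->
  hnorm (u + v) < 2 * eps.
Proof.
move=> hu hv; have u0 := hnorm_ge0 u; have v0 := hnorm_ge0 v.
have par : hnorm (u + v) ^+ 2 + hnorm (u - v) ^+ 2
           = 2 * hnorm u ^+ 2 + 2 * hnorm v ^+ 2.
  have ReN (z : R[i]) : Re (- z) = - Re z by case: z.
  by rewrite !hnorm_sqr dnormD dnormB !ReD ReN !ReD; ring.
rewrite ltNge; apply/negP => h.
have := sqr_ge0 (hnorm (u - v)); nra.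
Qed.

Section Family.
Context {I : eqType} (e : I -> V).

Definition closed_span v : Prop := forall eps : R, 0 < eps ->
  exists (s : seq I) (c : I -> R[i]),
    hnorm (v - \sum_(i <- s) c i *: e i) < eps.

(** An index list may contain repetitions, so moving to a duplicate-free list multiplies each
    coefficient by its multiplicity. Two combinations can then be added over one common list. *)
Lemma sum_seq_widen (s r : seq I) (c : I -> R[i]) : uniq r -> {subset s <= r} ->
  \sum_(i <- s) c i *: e i = \sum_(i <- r) (c i *+ count_mem i s) *: e i.
Proof.
move=> ur; elim: s => [|x s ih] sr.
  by rewrite big_nil big1// => i _; rewrite mulr0n scale0r.
rewrite big_cons ih => [|i si]; last by rewrite sr// inE si orbT.
have xr : x \in r by rewrite sr// inE eqxx.
rewrite [LHS]addrC -[RHS]/(\sum_(i <- r) (c i *+ ((x == i) + count_mem i s)) *: e i).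
rewrite [RHS](eq_bigr (fun i => (c i *+ count_mem i s) *: e i
                           + (c i *+ (x == i)) *: e i)); last first.
  by move=> i _; rewrite mulrnDr scalerDl addrC.
rewrite big_split /=; congr (_ + _).
rewrite (bigD1_seq x)//= eqxx big1 ?addr0// => i; rewrite eq_sym => /negbTE ->.
by rewrite mulr0n scale0r.
Qed.

Lemma closed_span_lim v :
  (forall eps : R, 0 < eps -> exists2 w, closed_span w & hnorm (v - w) < eps) ->
  closed_span v.
Proof.
move=> h eps eps0; have e2 : 0 < eps / 2 by rewrite divr_gt0.
have [w /(_ _ e2)[s [c wsc]] vw] := h _ e2; exists s, c.
have -> : eps = 2 * (eps / 2) by field.
by rewrite -(subrK w v) -addrA; exact: hnormD_lt.
Qed.

Lemma closed_spanZ a v : closed_span v -> closed_span (a *: v).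
Proof.
move=> h eps eps0.
have na : 0 < normc a + 1.
  by rewrite ltr_wpDl// normc_ge0.
have [s [c hsc]] := h (eps / (normc a + 1)) (divr_gt0 eps0 na).
exists s, (fun i => a * c i).
rewrite (eq_bigr (fun i => a *: (c i *: e i))); last first.
  by move=> i _; rewrite scalerA.
rewrite -scaler_sumr -scalerBr hnormZ.
move: hsc; rewrite ltr_pdivlMr//; apply: le_lt_trans.
by rewrite mulrC ler_wpM2l ?hnorm_ge0// lerDl.
Qed.

Lemma closed_spanD u v : closed_span u -> closed_span v -> closed_span (u + v).
Proof.
move=> hu hv eps eps0; have e2 : 0 < eps / 2 by rewrite divr_gt0.
have [s [c hs]] := hu _ e2; have [t [d ht]] := hv _ e2.
pose r := undup (s ++ t).
exists r, (fun i => c i *+ count_mem i s + d i *+ count_mem i t).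
under eq_bigr do rewrite scalerDl.
rewrite big_split /= -!sum_seq_widen ?undup_uniq//; last 2 first.
- by move=> i ti; rewrite mem_undup mem_cat ti orbT.
- by move=> i si; rewrite mem_undup mem_cat si.
have -> : eps = 2 * (eps / 2) by field.
by rewrite opprD addrACA; exact: hnormD_lt.
Qed.

Lemma closed_span_mem i : closed_span (e i).
Proof.
move=> eps eps0; exists [:: i], (fun=> 1).
by rewrite big_seq1 scale1r subrr hnorm0.
Qed.

Lemma closed_span0 : closed_span 0.
Proof. by move=> eps eps0; exists [::], (fun=> 0); rewrite big_nil subrr hnorm0. Qed.

End Family.
End ClosedSpan.

(** * Functions whose class lies in a closed span, and limits of such functions *)

Section SpanApproximation.
Context {R : realType} (a b : R) {I : eqType} (e : I -> L2 a b).
Let mu : {measure set measurableTypeR R -> \bar R} := lebesgue_measure.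
Let D : set R := `]a, b[%classic.
Let mD : measurable D. Proof. exact: measurable_itv. Qed.
Implicit Types (f g : R -> R[i]) (A : set R).

(** Square integrability is packed into the predicate, so that it applies to bare functions and can
    be transported along pointwise equalities. *)
Definition span_approx f : Prop := exists hf : f \in sqint a b,
  closed_span (@L2_dot R a b) e (L2_class (SqFun hf)).

Lemma span_approxD f g : span_approx f -> span_approx g ->
  span_approx (fun x => f x + g x).
Proof.
move=> [hf af] [hg ag].
exists (rpredD hf hg); move: (closed_spanD af ag).
by rewrite -L2_classD; congr closed_span; congr L2_class; exact: val_inj.
Qed.

Lemma span_approxZ c f : span_approx f -> span_approx (fun x => c * f x).
Proof.
move=> [hf af]; exists (rpredZ c hf); move: (closed_spanZ c af).
by rewrite -L2_classZ; congr closed_span; congr L2_class; exact: val_inj.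
Qed.

Lemma span_approx_sum (J : Type) (s : seq J) (c : J -> R[i]) (F : J -> R -> R[i]) :
  (forall j, span_approx (F j)) ->
  span_approx (fun x => \sum_(j <- s) c j * F j x).
Proof.
move=> aF; elim: s => [|j s ih].
  under eq_fun do rewrite big_nil.
  have h0 : (fun=> 0) \in sqint a b by exact: (rpred0 (sqint a b)).
  exists h0; rewrite (_ : L2_class _ = 0); first exact: closed_span0.
  rewrite -[RHS](scale0r (L2_class (SqFun h0))) -L2_classZ; congr L2_class.
  by apply: val_inj; apply/funext => x /=; change (0 = 0 * (0 : R[i])); rewrite mul0r.
under eq_fun do rewrite big_cons.
by apply: span_approxD => //; exact: span_approxZ.
Qed.

Lemma L2_hnorm_sqr (f : sqfun a b) : hnorm (@L2_dot R a b) (L2_class f) ^+ 2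
  = \int[mu]_(x in D) (normc (f x) ^+ 2).
Proof. by rewrite hnorm_sqr -[RHS]/(Re (_%:C)) -L2_dot_self. Qed.

Lemma hnorm_classB (f g : sqfun a b) :
  hnorm (@L2_dot R a b) (L2_class f - L2_class g) ^+ 2
  = \int[mu]_(x in D) (normc (f x - g x) ^+ 2).
Proof.
rewrite -scaleN1r -L2_classZ -L2_classD L2_hnorm_sqr.
apply: eq_Rintegral => x _; congr (normc _ ^+ 2).
by change (f x + (-1) * g x = f x - g x); rewrite mulN1r.
Qed.

Lemma real_sqint (f : R -> R) : measurable_fun D f ->
  mu.-integrable D (fun x => (f x ^+ 2)%:E) ->
  (fun x => (f x)%:C) \in sqint a b.
Proof.
move=> mf f2; rewrite inE; split => //; first exact: measurable_cst.
rewrite (_ : (fun x => _) = fun x => (f x ^+ 2)%:E)//; apply/funext => x.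
by rewrite normc2 /= expr0n addr0.
Qed.

(** Dominated convergence is applied to [(F n x - f x) ^+ 2], which is at most [4 * g x ^+ 2]
    because [F n] and [f] are both bounded by [g]. Hence [F n] tends to [f] in norm. *)
Lemma span_approx_lim (F : nat -> R -> R) (f g : R -> R) :
  (forall n, span_approx (fun x => (F n x)%:C)) ->
  measurable_fun D f -> mu.-integrable D (fun x => (g x ^+ 2)%:E) ->
  (forall n x, D x -> `|F n x| <= g x) -> (forall x, D x -> `|f x| <= g x) ->
  {ae mu, forall x, D x -> F^~ x @ \oo --> f x} ->
  span_approx (fun x => (f x)%:C).
Proof.
move=> aF mf ig Fg fg cvF.
have mF n : measurable_fun D (F n).
  by have [hF _] := aF n; move: hF; rewrite inE => -[].
have f2 : mu.-integrable D (fun x => (f x ^+ 2)%:E).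
  apply: le_integrable ig => //.
    by apply/measurable_EFinP; exact: measurable_funX.
  move=> x Dx; rewrite /= lee_fin !ger0_norm ?sqr_ge0// -(real_normK (num_real (f x))).
  by rewrite lerXn2r ?nnegrE// (le_trans _ (fg _ Dx)).
have hf := real_sqint mf f2; exists hf; apply: closed_span_lim => eps eps0.
have [||||| _ _] := @dominated_convergence _ _ R mu D mD
  (fun n x => ((F n x - f x) ^+ 2)%:E) (cst 0%E)
  (fun x => (4%:E * (g x ^+ 2)%:E)%E).
- move=> n; apply/measurable_EFinP; apply: measurable_funX.
  by apply: measurable_funB; [exact: mF|exact: mf].
- exact: measurable_cst.
- have FF := ae_filter_ringOfSetsType mu.
  apply: filterS cvF => x cv Dx; apply/cvg_EFin; first exact: nearW.
  rewrite /comp /=.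
  have -> : 0 = (f x - f x) ^+ 2 by rewrite subrr expr0n.
  apply: cvgM; (apply: cvgB; [exact: cv|exact: cvg_cst]).
- exact: integrableZl.
- apply: nearW => x n Dx; rewrite /= lee_fin ger0_norm ?sqr_ge0//.
  have := Fg n x Dx; have := fg x Dx; rewrite !ler_norml => /andP[? ?] /andP[? ?].
  nra.
rewrite integral0 => /fine_cvgP[_] /cvgrPdist_lt /(_ (eps ^+ 2)).
rewrite exprn_gt0// => /(_ isT) [N _ /(_ N (leqnn N))] /=.
rewrite sub0r normrN => hN.
have [hF cF] := aF N; exists (L2_class (SqFun hF)) => //.
rewrite -(@ltr_pXn2r _ 2)// ?nnegrE ?hnorm_ge0 ?ltW// hnorm_classB.
apply: le_lt_trans hN; apply: le_trans (ler_norm _).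
rewrite le_eqVlt; apply/orP; left; apply/eqP; congr fine.
apply: eq_integral => x _; congr EFin; rewrite normc2 /= subr0 expr0n addr0.
by rewrite -opprB sqrrN.
Qed.

End SpanApproximation.

(** * From rays to Borel sets to all square-integrable functions *)

Section BorelApproximation.
Context {R : realType} (a b : R) {I : eqType} (e : I -> L2 a b).
Let mu : {measure set measurableTypeR R -> \bar R} := lebesgue_measure.
Let D : set R := `]a, b[%classic.
Let mD : measurable D. Proof. exact: measurable_itv. Qed.
Hypothesis approx1 : span_approx e (fun=> 1).
Hypothesis approx_ray : forall c : R,
  span_approx e (fun x => (\1_(`]c, +oo[%classic) x)%:C).

Let integrable_const (k : R) : mu.-integrable D (fun=> k%:E).
Proof.
apply: (@integrableS _ _ _ mu `[a, b]%classic) => //.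
  by move=> x; rewrite /= !in_itv /= => /andP[/ltW -> /ltW ->].
apply: continuous_compact_integrable; first exact: segment_compact.
by apply: continuous_subspaceT => x; exact: cvg_cst.
Qed.

Let approxB (f g : R -> R) : span_approx e (fun x => (f x)%:C) ->
  span_approx e (fun x => (g x)%:C) -> span_approx e (fun x => (f x - g x)%:C).
Proof.
move=> hf /(span_approxZ (-1))/(span_approxD hf).
by congr span_approx; apply/funext => x; rewrite mulN1r rmorphB.
Qed.

Let approxD (f g : R -> R) : span_approx e (fun x => (f x)%:C) ->
  span_approx e (fun x => (g x)%:C) -> span_approx e (fun x => (f x + g x)%:C).
Proof.
move=> hf /(span_approxD hf).
by congr span_approx; apply/funext => x; rewrite rmorphD.
Qed.

Let approx_indic (A : set (measurableTypeR R)) : measurable A ->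
  span_approx e (fun x => (\1_A x : R)%:C).
Proof.
have approx0 : span_approx e (fun=> 0).
  have := approxB approx1 approx1; congr span_approx.
  by apply/funext => x; rewrite subrr.
move=> mA; have : (@RGenOInfty.G R).-sigma.-measurable A.
  by rewrite -RGenOInfty.measurableE.
move: A {mA}.
apply: (@dynkin_induction _ (measurableTypeR R) (@RGenOInfty.G R)
   (fun A => span_approx e (fun x => (\1_A x : R)%:C))).
- exact: RGenOInfty.measurableE.
(* Rays are stable under intersection, as a Dynkin class argument requires of its generators. *)
- move=> _ _ [x ->] [y ->]; exists (Num.max x y); apply/seteqP; split => z /=.
    by rewrite !in_itv /= !andbT gt_max => -[-> ->].
  by rewrite !in_itv /= !andbT gt_max => /andP[].
- by move: approx1; congr span_approx; apply/funext => x; rewrite indicT.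
- by move=> _ [x ->]; exact: approx_ray.
- move=> A mA aA; have := approxB approx1 aA; congr span_approx.
  apply/funext => x; rewrite !indicE in_setC.
  by case: (x \in A); rewrite ?subrr ?subr0.
- move=> F mF tF aF.
  pose G n := \bigcup_(k < n) F k.
  have aG n : span_approx e (fun x => (\1_(G n) x : R)%:C).
    elim: n => [|n ih].
      move: approx0; congr span_approx; apply/funext => x.
      by rewrite /G bigcup_mkord big_ord0 indic0.
    (* The set [F n] is disjoint from the earlier ones, so the indicator of the partial union is a
       sum of indicators. *)
    have := approxD ih (aF n); congr span_approx; apply/funext => x.
    congr (_%:C); rewrite /G !bigcup_mkord big_ord_recr /= -bigcup_mkord !indicE.
    rewrite in_setU; have [xn|] := boolP (x \in F n); last first.
      by rewrite orbF addr0.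
    have [xG|] := boolP (x \in _); last by rewrite add0r.
    exfalso; move: xG xn; rewrite !inE => -[k /= kn xk] xn.
    have := tF k n Logic.I Logic.I; move=> /(_ _)/eqP; rewrite ltn_eqF//.
    by move=> h; suff: false by []; apply: h; exists x.
  apply: (@span_approx_lim _ _ _ _ _ (fun n x => \1_(G n) x) _ (fun=> 1)) => //.
  + apply: measurable_funTS; apply: measurable_indic.
    by apply: (@bigcup_measurable _ (measurableTypeR R)) => k _; exact: mF.
  + exact: integrable_const.
  + by move=> n x _; rewrite indicE; case: (_ \in _); rewrite ?normr1 ?normr0.
  + by move=> x _; rewrite indicE; case: (_ \in _); rewrite ?normr1 ?normr0.
  (* At each point the indicators of the partial unions are eventually constant. *)
  + apply: nearW => x _; have [[k _ xk]|nx] := pselect ((\bigcup_k F k) x).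
      apply: (@cvg_near_cst _ _ _ _ _); exists k.+1 => // n /= kn.
      rewrite !indicE !mem_set//; last by exists k.
      by exists k.
    rewrite [X in _ --> X]indicE memNset//; apply: cvg_near_cst; apply: nearW => n.
    rewrite indicE memNset// => -[k _ xk]; apply: nx; by exists k.
Qed.

Import HBNNSimple.

(** The approximating simple functions stay below [f], so [f] itself is the dominating function.
    Each of them is a finite combination of indicators of its level sets. *)
Let approx_nonneg (f : R -> R) : (forall x, 0 <= f x) -> measurable_fun D f ->
  mu.-integrable D (fun x => (f x ^+ 2)%:E) ->
  span_approx e (fun x => (f x)%:C).
Proof.
move=> f0 mf if2.
have mEf : measurable_fun (D : set (measurableTypeR R)) (EFin \o f).
  exact/measurable_EFinP.
have Ef0 x : D x -> (0 <= (EFin \o f) x)%E by rewrite /= lee_fin.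
have s_le n x : D x -> nnsfun_approx mD mEf n x <= f x.
  by move=> Dx; rewrite nnsfun_approxE -lee_fin; exact: (le_approx n Ef0).
apply: (@span_approx_lim _ _ _ _ _ (fun n => nnsfun_approx mD mEf n) _ f) => //.
- move=> n; set h := nnsfun_approx mD mEf n.
  have := span_approx_sum (finmap.enum_fset (fset_set (range h))) (fun y => y%:C)
    (fun y => approx_indic (measurable_sfunP h (measurable_set1 y))).
  congr span_approx; apply/funext => x; rewrite (fimfunE h) fsbig_finite//=.
  by rewrite rmorph_sum /=; apply: eq_bigr => y _; rewrite rmorphM.
- by move=> n x Dx; rewrite ger0_norm ?s_le.
- by move=> x Dx; rewrite ger0_norm.
- apply: nearW => x Dx; have := cvg_nnsfun_approx mD mEf Ef0 Dx.
  by move=> /fine_cvgP[].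
Qed.

Let approx_real (f : R -> R) : measurable_fun D f ->
  mu.-integrable D (fun x => (f x ^+ 2)%:E) ->
  span_approx e (fun x => (f x)%:C).
Proof.
move=> mf if2.
(* The choices [s = 1] and [s = -1] give the positive and the negative part of [f]. *)
have part (s : R) : s ^+ 2 = 1 ->
    span_approx e (fun x => (Num.max (s * f x) 0)%:C).
  move=> s1.
  have mm : measurable_fun D (fun x => Num.max (s * f x) 0).
    by apply: measurable_maxr => //; exact: measurable_funM.
  apply: approx_nonneg => //; first by move=> x; rewrite le_max lexx orbT.
  apply: le_integrable if2 => //.
    by apply/measurable_EFinP; exact: measurable_funX.
  move=> x Dx; rewrite /= lee_fin !ger0_norm ?sqr_ge0//.
  have -> : f x ^+ 2 = (s * f x) ^+ 2 by rewrite exprMn s1 mul1r.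
  by rewrite maxEle; case: ifP => // _; rewrite expr0n sqr_ge0.
have := approxB (part 1 (expr1n _ _)) (part (-1) _); rewrite sqrrN expr1n.
move=> /(_ erefl); congr span_approx; apply/funext => x; congr (_%:C).
by rewrite mul1r mulN1r !maxEle; do 2 case: leP => ?; lra.
Qed.

Lemma borel_approx (f : R -> R[i]) : f \in sqint a b -> span_approx e f.
Proof.
rewrite inE => -[mr mi i2].
have ir : mu.-integrable D (fun x => (Re (f x) ^+ 2)%:E).
  apply: le_integrable i2 => //.
    by apply/measurable_EFinP; exact: (measurable_funX 2 mr).
  by move=> x Dx; rewrite /= lee_fin !ger0_norm ?sqr_ge0// normc2 lerDl sqr_ge0.
have ii : mu.-integrable D (fun x => (Im (f x) ^+ 2)%:E).
  apply: le_integrable i2 => //.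
    by apply/measurable_EFinP; exact: (measurable_funX 2 mi).
  by move=> x Dx; rewrite /= lee_fin !ger0_norm ?sqr_ge0// normc2 lerDr sqr_ge0.
have := span_approxD (approx_real mr ir) (span_approxZ 'i%C (approx_real mi ii)).
congr span_approx; apply/funext => x /=; case: (f x) => u v /=.
by simpc.
Qed.

End BorelApproximation.

(** * Polynomials that converge to a step function with its jump at 1/2 *)

Section Sharpening.
Context {R : realType}.
Implicit Types p x : R.

Lemma bernoulli_ineq x n : 0 <= x -> 1 + x *+ n <= (1 + x) ^+ n.
Proof.
move=> x0; elim: n => [|n ih]; first by rewrite mulr0n addr0 expr0.
rewrite exprS mulrSr; have xn : 0 <= x *+ n by rewrite mulrn_wge0.
nra.
Qed.

Lemma bernoulli_ineqB x n : 0 <= x <= 1 -> 1 - x *+ n <= (1 - x) ^+ n.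
Proof.
move=> /andP[x0 x1]; elim: n => [|n ih]; first by rewrite mulr0n subr0 expr0.
rewrite exprS mulrSr; have xn : 0 <= x *+ n by rewrite mulrn_wge0.
have : (1 - x) * (1 - x *+ n) <= (1 - x) * (1 - x) ^+ n.
  by rewrite ler_wpM2l ?subr_ge0.
nra.
Qed.

(* Bernoulli's inequality compares [(2 ^ n) * p ^+ n = (2 * p) ^+ n] with [1]. *)
Definition sharpen n p : R := (1 - p ^+ n) ^+ (2 ^ n).

Lemma sharpen_itv n p : 0 <= p <= 1 -> 0 <= sharpen n p <= 1.
Proof.
move=> /andP[p0 p1]; have pn0 := exprn_ge0 n p0; have pn1 := exprn_ile1 n p0 p1.
by rewrite /sharpen exprn_ge0 ?subr_ge0// exprn_ile1 ?subr_ge0// gerBl.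
Qed.

(** Bernoulli's inequality squeezes [sharpen n p] between [1 - (2 * p) ^+ n] and 1. *)
Lemma cvg_sharpen_lt p : 0 <= p < 2^-1 -> sharpen^~ p @ \oo --> (1 : R).
Proof.
move=> /andP[p0 p1].
have p2 : `|2 * p| < 1 by rewrite ger0_norm ?mulr_ge0//; lra.
have cvl : (fun n => 1 - geometric 1 (2 * p) n) @ \oo --> (1 : R).
  rewrite -[X in _ --> X]subr0; apply: cvgB; first exact: cvg_cst.
  exact: cvg_geometric.
apply: (squeeze_cvgr _ cvl (cvg_cst (1 : R))); apply: nearW => n.
have p01 : 0 <= p <= 1 by rewrite p0/=; lra.
have /andP[_ ->] := sharpen_itv n p01; rewrite andbT /geometric /= mul1r.
have /andP[q0 q1] : 0 <= p ^+ n <= 1.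
  by case/andP: p01 => ? ?; rewrite exprn_ge0//= exprn_ile1.
have := @bernoulli_ineqB (p ^+ n) (2 ^ n)%N; rewrite q0 q1 => /(_ isT).
by rewrite -[p ^+ n *+ _]mulr_natl natrX -exprMn.
Qed.

(** Since [(2 * p) ^+ n <= (1 + p ^+ n) ^+ (2 ^ n)], multiplying by [sharpen n p] leaves at most
    [(1 - (p ^+ n) ^+ 2) ^+ (2 ^ n) <= 1]. So [sharpen n p] is at most [(2 * p)^-1 ^+ n]. *)
Lemma cvg_sharpen_gt p : 2^-1 < p <= 1 -> sharpen^~ p @ \oo --> (0 : R).
Proof.
move=> /andP[p0 p1]; have p2 : 1 < 2 * p by lra.
have cvr : geometric 1 (2 * p)^-1 @ \oo --> (0 : R).
  apply: cvg_geometric; rewrite ger0_norm ?invr_ge0; last by lra.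
  by rewrite invf_lt1//; lra.
apply: (squeeze_cvgr _ (cvg_cst (0 : R)) cvr); apply: nearW => n.
have p01 : 0 <= p <= 1 by rewrite p1 andbT; lra.
have /andP[s0 _] := sharpen_itv n p01; rewrite s0 /geometric /= mul1r exprVn.
have /andP[q0 q1] : 0 <= p ^+ n <= 1.
  by case/andP: p01 => ? ?; rewrite exprn_ge0//= exprn_ile1.
have pn : 0 < (2 * p) ^+ n by rewrite exprn_gt0//; lra.
rewrite -[leRHS]mul1r ler_pdivlMr//.
have h1 : (2 * p) ^+ n <= (1 + p ^+ n) ^+ (2 ^ n).
  have := @bernoulli_ineq (p ^+ n) (2 ^ n)%N q0.
  by rewrite -[p ^+ n *+ _]mulr_natl natrX -exprMn; apply: le_trans; rewrite lerDr.
apply: (le_trans (ler_wpM2l s0 h1)).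
rewrite /sharpen -exprMn exprn_ile1//.
  by rewrite mulr_ge0 ?subr_ge0// addr_ge0.
by rewrite -subr_sqr expr1n gerBl sqr_ge0.
Qed.

End Sharpening.

(** * The exponentials [exp(2inx)] and their integrals over ]0, pi[ *)

Section Harmonics.
Context {R : realType}.
Implicit Types x c : R.
Let mu : {measure set measurableTypeR R -> \bar R} := lebesgue_measure.

Definition fourier_mode (n : int) x : R[i] :=
  Complex (cos ((2 * n)%:~R * x)) (sin ((2 * n)%:~R * x)).

Lemma fourier_mode0 x : fourier_mode 0 x = 1.
Proof. by rewrite /fourier_mode mulr0 mul0r cos0 sin0. Qed.

Lemma fourier_modeD n m x : fourier_mode (n + m) x = fourier_mode n x * fourier_mode m x.
Proof.
rewrite /fourier_mode mulrDr rmorphD /= mulrDl cosD sinD; simpc.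
by congr Complex; rewrite addrC.
Qed.

Lemma fourier_mode_conj n x : (fourier_mode n x)^* = fourier_mode (- n) x.
Proof.
rewrite -[LHS]/(conjc (fourier_mode n x)) /fourier_mode /=.
by rewrite mulrN rmorphN mulNr cosN sinN.
Qed.

Lemma fourier_mode_pi n : fourier_mode n pi = 1.
Proof.
have h (k : nat) : fourier_mode k pi = 1.
  have e : (2 * k%:Z)%:~R * pi = 0 + (pi *+ 2) *+ k :> R.
    by rewrite add0r -PoszM -pmulrn natrM -mulr_natl -[pi *+ 2]mulr_natl; ring.
  by rewrite /fourier_mode e (periodicn (@cosD2pi R)) (periodicn (@sinD2pi R)) cos0 sin0.
case: n => k; first exact: h.
rewrite NegzE -fourier_mode_conj h; exact: conjc1.
Qed.

Lemma fourier_mode_reflect n x : fourier_mode n (pi - x) = fourier_mode (- n) x.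
Proof.
have := fourier_mode_pi n; rewrite /fourier_mode mulrBr cosB sinB => -[-> ->].
by rewrite !mul1r !mul0r addr0 sub0r mulrN rmorphN mulNr cosN sinN.
Qed.

Let mulC (k : R) : continuous (fun x => k * x : R^o).
Proof. by move=> x; apply: cvgM; [exact: cvg_cst|exact: cvg_id]. Qed.

Let cosC (k : R) : continuous (fun x => cos (k * x) : R^o).
Proof.
by move=> x; apply: (continuous_comp (f := fun x : R => k * x : R) (g := cos));
  [exact: mulC|exact: continuous_cos].
Qed.

Let sinC (k : R) : continuous (fun x => sin (k * x) : R^o).
Proof.
by move=> x; apply: (continuous_comp (f := fun x : R => k * x : R) (g := sin));
  [exact: mulC|exact: continuous_sin].
Qed.

Lemma fourier_mode_sqint (a b : R) n : fourier_mode n \in sqint a b.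
Proof. by apply: continuous_sqint; [exact: cosC|exact: sinC]. Qed.

(** The endpoints are null, so the fundamental theorem on the closed interval carries over to the
    open one on which [L2] is built. *)
Lemma Rintegral_itv_oo_FTC (f F : R -> R) (a b : R) : a < b ->
  continuous (f : R -> R^o) -> (forall x, is_derive x (1 : R) (F : R -> R^o) (f x)) ->
  \int[mu]_(x in `]a, b[) f x = F b - F a.
Proof.
move=> ab cf dF.
have mf (D : set R) : measurable D -> measurable_fun D (EFin \o f).
  move=> mD; apply/measurable_EFinP; apply: measurable_funTS.
  exact: continuous_measurable_fun.
have cF x : {for x, continuous F}.
  by apply: differentiable_continuous; apply/derivable1_diffP; have [] := dF x.
rewrite /Rintegral integral_itv_obnd_cbnd; last exact: mf.
rewrite integral_itv_bndo_bndc; last exact: mf.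
rewrite (@continuous_FTC2 _ f F)//.
- exact: continuous_subspaceT.
- split; first by move=> x _; have [] := dF x.
  + exact/cvg_at_right_filter/cF.
  + exact/cvg_at_left_filter/cF.
- by move=> x _; rewrite derive1E; have [_ ->] := dF x.
Qed.

Lemma cintegral_fourier_mode n : cintegral 0 pi (fourier_mode n) = (n == 0)%:R * pi%:C.
Proof.
have pi0 := @pi_gt0 R.
have [->|n0] := eqVneq n 0.
  rewrite mul1r /cintegral; congr Complex.
    under eq_Rintegral do rewrite fourier_mode0 /=.
    rewrite (@Rintegral_itv_oo_FTC (fun=> 1) id)// ?subr0//.
    by move=> x; exact: cvg_cst.
  under eq_Rintegral do rewrite fourier_mode0 /=.
  rewrite (@Rintegral_itv_oo_FTC (fun=> 0) (fun=> 0))// ?subr0//.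
  by move=> x; exact: cvg_cst.
rewrite mul0r; set k : R := (2 * n)%:~R.
have k0 : k != 0 by rewrite intr_eq0 mulf_neq0.
have [cpi spi] : cos (k * pi) = 1 /\ sin (k * pi) = 0.
  by have [] := fourier_mode_pi n.
have dk x : is_derive x (1 : R) (fun x => k * x : R^o) k.
  by apply: is_derive_eq; rewrite /GRing.scale /= mulr1.
(* The antiderivatives [sin (k * x) / k] and [- cos (k * x) / k] agree at 0 and [pi], because [k] is
   an even integer. *)
have dsin x : is_derive x (1 : R) (fun x => k^-1 * sin (k * x) : R^o) (cos (k * x)).
  have h := @is_derive1_comp _ (@sin R) (fun x => k * x) x _ _ (is_derive_sin _) (dk x).
  apply: is_derive_eq; rewrite /GRing.scale /=.
  by clearbody k; field.
have dcos x : is_derive x (1 : R) (fun x => - k^-1 * cos (k * x) : R^o) (sin (k * x)).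
  have h := @is_derive1_comp _ (@cos R) (fun x => k * x) x _ _ (is_derive_cos _) (dk x).
  apply: is_derive_eq; rewrite /GRing.scale /=.
  by clearbody k; field.
rewrite /cintegral -[RHS]/(Complex 0 0); congr Complex.
  rewrite (Rintegral_itv_oo_FTC pi0 (@cosC k) dsin).
  by rewrite spi !mulr0 sin0 mulr0 subr0.
rewrite (Rintegral_itv_oo_FTC pi0 (@sinC k) dcos).
by rewrite cpi mulr0 cos0 subrr.
Qed.

(** * Trigonometric polynomials and the separation of points of ]0, pi[ *)

Definition trig_poly (f : R -> R[i]) : Prop :=
  exists s : seq (int * R[i]), forall x, f x = \sum_(p <- s) p.2 * fourier_mode p.1 x.

Lemma trig_poly_cst (c : R[i]) : trig_poly (fun=> c).
Proof. by exists [:: (0, c)] => x; rewrite big_seq1 fourier_mode0 mulr1. Qed.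

Lemma trig_polyD f g : trig_poly f -> trig_poly g -> trig_poly (fun x => f x + g x).
Proof. by move=> [s sE] [t tE]; exists (s ++ t) => x; rewrite big_cat sE tE. Qed.

Lemma trig_polyM f g : trig_poly f -> trig_poly g -> trig_poly (fun x => f x * g x).
Proof.
move=> [s sE] [t tE].
(* Frequencies may repeat in the list, so all pairs are listed without collecting equal
   frequencies. *)
exists [seq (u.1.1 + u.2.1, u.1.2 * u.2.2) | u <- [seq (p, q) | p <- s, q <- t]] => x.
rewrite big_map big_allpairs sE tE big_distrl /=; apply: eq_bigr => p _.
rewrite big_distrr /=; apply: eq_bigr => q _.
by rewrite fourier_modeD mulrACA.
Qed.

Lemma trig_polyX f n : trig_poly f -> trig_poly (fun x => f x ^+ n).
Proof.
move=> tf; elim: n => [|n ih]; first exact: trig_poly_cst.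
by under eq_fun do rewrite exprS; exact: trig_polyM.
Qed.

Lemma trig_polyBl (c : R[i]) f : trig_poly f -> trig_poly (fun x => c - f x).
Proof.
move=> tf; have := trig_polyD (trig_poly_cst c) (trig_polyM (trig_poly_cst (-1)) tf).
by congr trig_poly; apply/funext => x; rewrite mulN1r.
Qed.

(* A trigonometric polynomial, since
   [2 * sin x * sin (x - c) = cos c - cos (2 * x - c)]. *)
Definition sine_separator c x : R := (1 + sin x * sin (x - c)) / 2.

Lemma trig_poly_separator c : trig_poly (fun x => (sine_separator c x)%:C).
Proof.
(* The function is [1/2 + cos c / 4 - cos (2 * x - c) / 4]. Splitting the last cosine into
   exponentials gives the coefficients [- exp(-ic) / 8] and [- exp(ic) / 8] at the frequencies 1 and
   -1. *)
exists [:: (0, (2^-1 + cos c / 4)%:C);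
  (1, Complex (- cos c / 8) (sin c / 8)); (-1, Complex (- cos c / 8) (- sin c / 8))] => x.
rewrite !big_cons big_nil [_.1]/= [_.2]/= fourier_mode0 /fourier_mode /sine_separator /=.
have -> : (2 * 1 : int)%:~R * x = x + x by rewrite mulr1 -[x in RHS]mul1r -mulrDl.
have -> : (2 * -1 : int)%:~R * x = - (x + x).
  by rewrite mulrN1 mulrNz mulNr -[x in RHS]mul1r -mulrDl.
rewrite cosN sinN sinB cosD sinD; simpc; congr Complex.
  have := cos2Dsin2 x; set s := sin x; set k := cos x => h.
  have -> : k * k = 1 - s ^+ 2 by rewrite -h; ring.
  by field.
by ring.
Qed.

Lemma sine_separator_itv c x : 0 <= sine_separator c x <= 1.
Proof.
have := sin_le1 x; have := sin_geN1 x; have := sin_le1 (x - c).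
have := sin_geN1 (x - c); rewrite /sine_separator => *; apply/andP; split; nra.
Qed.

(** Both [x] and [x - c] lie in ]0, pi[, where the sine is positive. For [x < c] the second factor
    changes sign. *)
Lemma sine_separator_gt c x : 0 <= c <= pi -> 0 < x < pi -> c < x ->
  2^-1 < sine_separator c x.
Proof.
move=> /andP[c0 cpi] /andP[x0 xpi] cx.
have s1 : 0 < sin x by rewrite sin_gt0_pi// x0.
have s2 : 0 < sin (x - c) by rewrite sin_gt0_pi//; apply/andP; split; lra.
by rewrite /sine_separator; have := mulr_gt0 s1 s2; lra.
Qed.

Lemma sine_separator_lt c x : 0 <= c <= pi -> 0 < x < pi -> x < c ->
  sine_separator c x < 2^-1.
Proof.
move=> /andP[c0 cpi] /andP[x0 xpi] cx.
have s1 : 0 < sin x by rewrite sin_gt0_pi// x0.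
have s2 : 0 < sin (c - x) by rewrite sin_gt0_pi//; apply/andP; split; lra.
by rewrite /sine_separator -(opprB c) sinN; have := mulr_gt0 s1 s2; lra.
Qed.

(** * The orthonormal basis [exp(2inx) / sqrt pi] of [L2] on ]0, pi[ *)

Lemma fourier_fun_sqint n :
  (((Num.sqrt pi)^-1)%:C : R[i]) *: fourier_mode n \in sqint 0 pi.
Proof. exact: rpredZ (fourier_mode_sqint _ _ _). Qed.

Definition fourier n : L2 (0 : R) pi := L2_class (SqFun (fourier_fun_sqint n)).

Lemma fourier_orthonormal n m : L2_dot (fourier n) (fourier m) = (n == m)%:R.
Proof.
rewrite L2_dot_class.
have -> : (fun x => SqFun (fourier_fun_sqint n) x * (SqFun (fourier_fun_sqint m) x)^*)
    = (fun x => (pi^-1)%:C * fourier_mode (n - m) x).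
  apply/funext => x /=; set c : R[i] := _%:C.
  change (c * fourier_mode n x * (c * fourier_mode m x)^*
    = (pi^-1)%:C * fourier_mode (n - m) x).
  rewrite rmorphM /= fourier_mode_conj mulrACA -fourier_modeD; congr (_ * _).
  rewrite -[c^*]/(conjc c) conjc_real -rmorphM /= -invfM -expr2.
  by rewrite sqr_sqrtr// pi_ge0.
rewrite cintegralZ; last first.
  have := sqfun_cintegrable (SqFun (fourier_mode_sqint 0 pi (n - m)))
    (SqFun (fourier_mode_sqint 0 pi 0)).
  congr cintegrable; apply/funext => x /=.
  by rewrite fourier_mode0 -[X in _ * X]/(conjc 1) conjc1 mulr1.
have piV : (pi^-1)%:C * pi%:C = 1 :> R[i].
  by rewrite -rmorphM mulVf ?rmorph1// gt_eqF// pi_gt0.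
by rewrite cintegral_fourier_mode mulrCA piV mulr1 subr_eq0.
Qed.

Lemma span_approx_fourier_mode n : span_approx fourier (fourier_mode n).
Proof.
have : span_approx fourier (((Num.sqrt pi)^-1)%:C *: fourier_mode n).
  by exists (fourier_fun_sqint n); exact: closed_span_mem.
move=> /(span_approxZ (Num.sqrt pi)%:C); congr span_approx.
apply/funext => x.
change ((Num.sqrt pi)%:C * (((Num.sqrt pi)^-1)%:C * fourier_mode n x) = fourier_mode n x).
by rewrite mulrA -rmorphM /= mulfV ?mul1r// sqrtr_eq0 -ltNge pi_gt0.
Qed.

Lemma span_approx_trig_poly f : trig_poly f -> span_approx fourier f.
Proof.
move=> [s /funext ->]; apply: span_approx_sum => p; exact: span_approx_fourier_mode.
Qed.

(** The functions [1 - sharpen n (sine_separator d x)] are trigonometric polynomials with values in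
    [0, 1] that converge almost everywhere on ]0, pi[ to the indicator. *)
Lemma span_approx_ray c :
  span_approx fourier (fun x => (\1_(`]c, +oo[%classic) x : R)%:C).
Proof.
(* Clamping [c] to [0, pi] leaves the trace of the ray on ]0, pi[ unchanged and meets the range
   condition of the separator. *)
pose d := Num.max 0 (Num.min c pi).
have d01 : 0 <= d <= pi.
  by rewrite /d le_max lexx /= ge_max pi_ge0 ge_min lexx orbT.
have ind_le1 (A : set R) x : `|\1_A x : R| <= 1.
  by rewrite indicE; case: (_ \in _); rewrite ?normr1 ?normr0.
apply: (@span_approx_lim _ _ _ _ _ (fun n x => 1 - sharpen n (sine_separator d x)) _
  (fun=> 1)) => //.
- move=> n; apply: span_approx_trig_poly.
  have := trig_polyBl 1 (trig_polyX (2 ^ n) (trig_polyBl 1 (trig_polyX n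
    (trig_poly_separator d)))).
  congr trig_poly; apply/funext => x; rewrite /sharpen.
  by rewrite rmorphB rmorphXn rmorphB rmorphXn rmorph1.
- have := fourier_mode_sqint 0 pi 0; rewrite inE => -[_ _].
  congr integrable; apply/funext => x; rewrite fourier_mode0 expr1n.
  by rewrite normc2 /= expr1n expr0n addr0.
- move=> n x _; have := sharpen_itv n (sine_separator_itv d x).
  by rewrite ler_norml => /andP[? ?]; apply/andP; split; lra.
have FF := ae_filter_ringOfSetsType mu.
(* At [x = d] the separator equals 1/2, which neither limit of [sharpen] covers; a single point is
   null. *)
have : {ae mu, forall x, x != d}.
  exists [set d]; split => //; first exact: lebesgue_measure_set1.
  by move=> x /= /negP; rewrite negbK => /eqP.
apply: filterS => x xd; rewrite /= in_itv /= => xpi.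
have cd : (c < x) = (d < x).
  case/andP: xpi => x0 xp.
  by rewrite /d gt_max x0 /= gt_min (ltNge pi) (ltW xp) orbF.
rewrite indicE; have [] := ltgtP x d.
- move=> lt_xd.
  rewrite memNset; last by rewrite /= in_itv /= andbT cd; apply/negP; rewrite -leNgt ltW.
  have cv : sharpen^~ (sine_separator d x) @ \oo --> (1 : R).
    apply: cvg_sharpen_lt; rewrite sine_separator_lt// andbT.
    by case/andP: (sine_separator_itv d x).
  by rewrite -[X in _ --> X](subrr 1); apply: cvgB => //; exact: cvg_cst.
- move=> lt_dx.
  rewrite mem_set; last by rewrite /= in_itv /= andbT cd.
  have cv : sharpen^~ (sine_separator d x) @ \oo --> (0 : R).
    apply: cvg_sharpen_gt; rewrite sine_separator_gt//.
    by case/andP: (sine_separator_itv d x).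
  by rewrite -[X in _ --> X](subr0 1); apply: cvgB => //; exact: cvg_cst.
- by move=> /eqP; rewrite (negbTE xd).
Qed.

Lemma fourier_basis : orthonormal_basis (@L2_dot R 0 pi) fourier.
Proof.
split; first exact: fourier_orthonormal.
suff h : forall v : L2 0 pi, closed_span (@L2_dot R 0 pi) fourier v by exact: h.
apply: L2_ind => -[f hf].
have [|hf' +] := @borel_approx _ _ _ _ fourier _ span_approx_ray f hf.
  have := span_approx_fourier_mode 0; congr span_approx.
  by apply/funext => x; exact: fourier_mode0.
by congr (closed_span _ _ (L2_class _)); exact: val_inj.
Qed.

End Harmonics.

(** * Sums and composites of bounded operators *)

Section BoundedOperators.
Context {R : realType} {V : lmodType R[i]} (dot : {dot V for Num.conj}).

Lemma hnorm_eq0 v : hnorm dot v = 0 -> v = 0.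
Proof.
move=> v0; apply/eqP; rewrite -(dnorm_eq0 dot).
by rewrite (dot_self dot v) v0 expr0n.
Qed.

(** The definition admits a negative constant; a nonnegative one lets inequalities between norms be
    multiplied by it. *)
Lemma bounded_operator_ge0 (T : V -> V) : bounded_operator dot T ->
  exists2 M : R, 0 <= M & forall v, hnorm dot (T v) <= M * hnorm dot v.
Proof.
move=> [M TM]; exists `|M| => // v; apply: (le_trans (TM v)).
by rewrite ler_wpM2r ?hnorm_ge0// ler_norm.
Qed.

Lemma bounded_operatorM (T S : V -> V) : bounded_operator dot T ->
  bounded_operator dot S -> bounded_operator dot (T \o S).
Proof.
move=> /bounded_operator_ge0[M M0 TM] [N SN]; exists (M * N) => v /=.
by apply: (le_trans (TM _)); rewrite -mulrA ler_wpM2l.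
Qed.

Lemma bounded_operatorD (T S : V -> V) : bounded_operator dot T ->
  bounded_operator dot S -> bounded_operator dot (T \+ S).
Proof.
move=> /bounded_operator_ge0[M M0 TM] /bounded_operator_ge0[N N0 SN].
exists (2 * (M + N)) => v /=; have [v0|v0] := eqVneq (hnorm dot v) 0.
  have z T' K : (forall v, hnorm dot (T' v) <= K * hnorm dot v) -> T' v = 0.
    move=> h; apply: hnorm_eq0; apply/eqP; rewrite eq_le hnorm_ge0 andbT.
    by have := h v; rewrite v0 mulr0.
  by rewrite (z T M TM) (z S N SN) addr0 hnorm0 v0 mulr0.
have vgt0 : 0 < hnorm dot v by rewrite lt_neqAle eq_sym v0 hnorm_ge0.
(* [hnormD_lt] wants one strict bound for both summands: [(M + N) * hnorm dot v] plus the slack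
   [e / 2] is such a bound. *)
apply/ler_addgt0Pr => e e0; rewrite -mulrA.
have -> : 2 * ((M + N) * hnorm dot v) + e = 2 * ((M + N) * hnorm dot v + e / 2).
  by field.
apply/ltW/hnormD_lt.
  apply: (le_lt_trans (TM v)); have := mulr_ge0 N0 (hnorm_ge0 dot v); nra.
apply: (le_lt_trans (SN v)); have := mulr_ge0 M0 (hnorm_ge0 dot v); nra.
Qed.

End BoundedOperators.

(** * Multiplication and reflection operators on [L2] *)

Section L2Operators.
Context {R : realType} (a b : R).
Let mu : {measure set measurableTypeR R -> \bar R} := lebesgue_measure.
Let D : set R := `]a, b[%classic.
Let mD : measurable D. Proof. exact: measurable_itv. Qed.
Local Notation dot := (@L2_dot R a b).

Lemma L2_class_repr (u : L2 a b) : L2_class (repr u) = u.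
Proof. exact: reprK. Qed.

(* Boundedness makes [phi] compatible with almost everywhere equality. *)
Lemma L2_lift (phi : sqfun a b -> sqfun a b) (M : R) : linear phi ->
  (forall f, hnorm dot (L2_class (phi f)) <= M * hnorm dot (L2_class f)) ->
  exists T : {linear L2 a b -> L2 a b}, bounded_operator dot T /\
    forall f, T (L2_class f) = L2_class (phi f).
Proof.
move=> lin bnd.
have compat f g : L2_class f = L2_class g -> L2_class (phi f) = L2_class (phi g).
  move=> fg; have := bnd ((-1) *: f + g).
  rewrite lin !L2_classD !L2_classZ fg !scaleN1r [X in M * hnorm _ X]addNr.
  rewrite hnorm0 mulr0 => h0; apply/eqP; rewrite eq_sym -subr_eq0 addrC; apply/eqP.
  by apply: (@hnorm_eq0 _ _ dot); apply/eqP; rewrite eq_le hnorm_ge0 andbT.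
pose t (u : L2 a b) : L2 a b := L2_class (phi (repr u)).
have tE f : t (L2_class f) = L2_class (phi f).
  by apply: compat; rewrite L2_class_repr.
have tlin : linear t.
  move=> c u v; rewrite -[u]L2_class_repr -[v]L2_class_repr.
  by rewrite -L2_classZ -L2_classD !tE lin L2_classD L2_classZ.
pose T : {linear L2 a b -> L2 a b} := HB.pack t (GRing.isLinear.Build _ _ _ _ t tlin).
exists T; split; last exact: tE.
exists M => u; rewrite -[u]L2_class_repr.
by change (hnorm dot (t (L2_class (repr u))) <= M * hnorm dot (L2_class (repr u)));
  rewrite tE.
Qed.

Definition multiplier (A : R -> R[i]) : Prop :=
  [/\ measurable_fun D (Re \o A), measurable_fun D (Im \o A) &
      exists M : R, forall x, D x -> normc (A x) <= M].

Lemma multiplier_sqint A (f : sqfun a b) : multiplier A ->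
  (fun x => A x * f x) \in sqint a b.
Proof.
move=> [mr mi [M AM]]; have [fr fi f2] := sqfunP f.
have mre : measurable_fun D (Re \o (fun x => A x * f x)).
  rewrite (_ : _ \o _ = fun x => Re (A x) * Re (f x) - Im (A x) * Im (f x)).
    by apply: measurable_funB; apply: measurable_funM.
  by apply/funext => x /=; rewrite ReM.
have mim : measurable_fun D (Im \o (fun x => A x * f x)).
  rewrite (_ : _ \o _ = fun x => Re (A x) * Im (f x) + Im (A x) * Re (f x)).
    by apply: measurable_funD; apply: measurable_funM.
  by apply/funext => x /=; rewrite ImM.
rewrite inE; split => //.
have : mu.-integrable D (fun x => ((M ^+ 2)%:E * (normc (f x) ^+ 2)%:E)%E).
  exact: integrableZl.
apply: le_integrable => //.
  apply/measurable_EFinP.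
  rewrite (_ : (fun x => _) = fun x => Re (A x * f x) ^+ 2 + Im (A x * f x) ^+ 2).
    by apply: measurable_funD; apply: (measurable_funX 2).
  by apply/funext => x; rewrite normc2.
move=> x Dx; rewrite -EFinM !abse_EFin lee_fin -exprMn !ger0_norm ?sqr_ge0// exprMn.
rewrite ComplexField.Normc.normcM exprMn ler_wpM2r ?sqr_ge0//.
by have := AM x Dx; have := normc_ge0 (A x); nra.
Qed.

Lemma multiplication_operator A : multiplier A ->
  exists T : {linear L2 a b -> L2 a b}, bounded_operator dot T /\
    forall f g : sqfun a b, (forall x, g x = A x * f x) ->
      T (L2_class f) = L2_class g.
Proof.
move=> mA; have [_ _ [M AM]] := mA.
pose phi f := SqFun (multiplier_sqint f mA).
have [||T [bT TE]] := @L2_lift phi `|M|.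
- move=> c f g; apply: val_inj; apply/funext => x.
  change (A x * (c * f x + g x) = c * (A x * f x) + A x * g x).
  by rewrite mulrDr mulrCA.
- move=> f; rewrite -(@ler_pXn2r _ 2)// ?nnegrE ?mulr_ge0 ?hnorm_ge0//.
  rewrite exprMn !L2_hnorm_sqr real_normK ?num_real//.
  have [_ _ f2] := sqfunP f; have [_ _ p2] := sqfunP (phi f).
  rewrite -RintegralZl//; apply: le_Rintegral => //.
    exact: (@integrableZl _ _ _ mu D mD (M ^+ 2) _ f2).
  move=> x Dx; rewrite [phi f x]/(A x * f x) ComplexField.Normc.normcM exprMn.
  rewrite ler_wpM2r ?sqr_ge0//.
  by have := AM x Dx; have := normc_ge0 (A x); nra.
exists T; split => // f g gE; rewrite TE; congr L2_class; apply: val_inj.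
by apply/funext => x /=; rewrite gE.
Qed.

Let rho (x : R) : R := a + b - x.

Let rho_D x : D (rho x) <-> D x.
Proof.
rewrite /D /rho /= !in_itv /=; split=> /andP[h1 h2]; apply/andP; split; lra.
Qed.

Let measurable_rho : measurable_fun [set: R] (rho : R -> measurableTypeR R).
Proof. by apply: measurable_funB; [exact: measurable_cst|exact: measurable_id]. Qed.

(** By uniqueness of Lebesgue measure it suffices to test intervals []x, y]]. Their preimages are
    closed on the left instead of the right, but have the same length. *)
Let lebesgue_measure_rho (A : set R) : measurable A ->
  pushforward mu (rho : _ -> measurableTypeR R) A = mu A.
Proof.
move=> mA; apply/esym/lebesgue_measure_unique => //= _ [[x y]] _ <-.
rewrite /pushforward /=.
have -> : rho @^-1` `]x, y]%classic = `[a + b - y, a + b - x[%classic.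
  apply/seteqP; rewrite /rho; split=> z /=; rewrite !in_itv /= => /andP[h1 h2];
    apply/andP; split; lra.
rewrite /mu !lebesgue_measure_itv /= !lte_fin.
have -> : (a + b - y < a + b - x) = (x < y) by apply/idP/idP; lra.
by case: ifP => // _; rewrite -!EFinB; congr EFin; ring.
Qed.

Let ge0_integral_rho (h : R -> \bar R) : measurable_fun D h ->
  (forall x, (0 <= h x)%E) ->
  (\int[mu]_(x in D) h (rho x) = \int[mu]_(x in D) h x)%E.
Proof.
move=> mh h0.
have e : (rho : _ -> measurableTypeR R) @^-1` D = D.
  by apply/seteqP; split => x /rho_D.
transitivity (\int[pushforward mu (rho : _ -> measurableTypeR R)]_(x in D) h x)%E.
  by rewrite ge0_integral_pushforward//= e.
by apply: eq_measure_integral => //= A mA _; exact: lebesgue_measure_rho.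
Qed.

Let measurable_comp_rho d (T : measurableType d) (h : R -> T) :
  measurable_fun D h -> measurable_fun D (h \o rho).
Proof.
move=> mh; apply: (measurable_comp mD _ mh) => //.
  by move=> _ [x Dx <-]; apply/rho_D.
exact: measurable_funTS.
Qed.

Let rho_sqint (f : sqfun a b) : (fun x => f (rho x)) \in sqint a b.
Proof.
have [fr fi f2] := sqfunP f; rewrite inE; split.
- exact: (measurable_comp_rho fr).
- exact: (measurable_comp_rho fi).
have mf2 := measurable_int _ f2.
apply/integrableP; split; first exact: (measurable_comp_rho mf2).
have f0 x : (0 <= (normc (f x) ^+ 2)%:E)%E by rewrite lee_fin sqr_ge0.
have := ge0_integral_rho mf2 f0.
rewrite (_ : (\int[_]_(x in _) `|_|)%E = \int[mu]_(x in D) (normc (f (rho x)) ^+ 2)%:E)%E.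
  by move=> ->; exact: integrable_lty f2.
by apply: eq_integral => x _; rewrite gee0_abs// lee_fin sqr_ge0.
Qed.

Lemma reflection_operator :
  exists T : {linear L2 a b -> L2 a b}, bounded_operator dot T /\
    forall f g : sqfun a b, (forall x, g x = f (a + b - x)) ->
      T (L2_class f) = L2_class g.
Proof.
pose phi f := SqFun (rho_sqint f).
have [||T [bT TE]] := @L2_lift phi 1.
- by move=> c f g; apply: val_inj; apply/funext => x.
- move=> f; rewrite mul1r -(@ler_pXn2r _ 2)// ?nnegrE ?hnorm_ge0//.
  rewrite !L2_hnorm_sqr le_eqVlt; apply/orP; left; apply/eqP; congr fine.
  apply: (@ge0_integral_rho (fun x => (normc (f x) ^+ 2)%:E)).
    by have [_ _ /measurable_int] := sqfunP f.
  by move=> x; rewrite lee_fin sqr_ge0.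
exists T; split => // f g gE; rewrite TE; congr L2_class; apply: val_inj.
by apply/funext => x /=; rewrite gE.
Qed.

(** This is the common shape of the operator in the theorem and of its inverse. The image comes with
    a representative known at every point, so composites can be computed pointwise. *)
Lemma reflected_multiplication_operator A B : multiplier A -> multiplier B ->
  exists T : {linear L2 a b -> L2 a b}, bounded_operator dot T /\
    forall f : sqfun a b, exists2 g : sqfun a b,
      (forall x, g x = A x * f x + B x * f (a + b - x)) &
      T (L2_class f) = L2_class g.
Proof.
move=> mA mB.
have [TA [bA TAE]] := multiplication_operator mA.
have [TB [bB TBE]] := multiplication_operator mB.
have [P [bP PE]] := reflection_operator.
exists (TA \+ (TB \o P) : {linear L2 a b -> L2 a b}); split.
  by apply: bounded_operatorD => //; exact: bounded_operatorM.
move=> f; pose fr := SqFun (rho_sqint f).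
pose g1 := SqFun (multiplier_sqint f mA); pose g2 := SqFun (multiplier_sqint fr mB).
exists (g1 + g2) => //.
by rewrite /= (TAE f g1)// (PE f fr)// (TBE fr g2)// L2_classD.
Qed.

End L2Operators.

(** * The complex exponential and the zeros of the complex sine *)

Section ComplexExponential.
Context {R : realType}.
Implicit Types (z w c : R[i]) (x : R).

Lemma cexpD z w : cexp (z + w) = cexp z * cexp w.
Proof.
case: z w => [p q] [r s]; rewrite /cexp /=; simpc.
by rewrite expRD cosD sinD; congr Complex; ring.
Qed.

Lemma cexp0 : cexp 0 = 1 :> R[i].
Proof. by rewrite /cexp /= expR0 cos0 sin0 !mul1r. Qed.

Lemma cexpN_mul z : cexp z * cexp (- z) = 1.
Proof. by rewrite -cexpD subrr cexp0. Qed.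

Lemma cexp_fourier_mode (n : int) x :
  cexp ('i%C * ((2 * n)%:~R * x%:C)) = fourier_mode n x.
Proof.
have -> : (2 * n)%:~R = ((2 * n)%:~R : R)%:C by rewrite rmorph_int.
rewrite -rmorphM /cexp /fourier_mode ReM ImM /= !mul0r mul1r subr0 add0r.
by rewrite expR0 !mul1r.
Qed.

Lemma normc_cexp z : normc (cexp z) = expR (Re z).
Proof.
rewrite /cexp /= !exprMn -mulrDr cos2Dsin2 mulr1 sqrtr_sqr ger0_norm//.
Qed.

Lemma multiplier_cexp (a b : R) c z : multiplier a b (fun x => c * cexp (z * x%:C)).
Proof.
have zx x : z * x%:C = Complex (Re z * x) (Im z * x).
  by apply/eqP; rewrite eq_complex ReM ImM /= !mulr0 subr0 add0r !eqxx.
have mM (k : R) (D : set R) : measurable_fun D (fun x : R => k * x).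
  by apply: measurable_funM; [exact: measurable_cst|exact: measurable_id].
have mr (D : set R) : measurable_fun D (fun x => Re (cexp (z * x%:C))).
  under eq_fun do rewrite zx /=.
  apply: measurable_funM; first exact: measurableT_comp.
  by apply: measurableT_comp => //; exact: continuous_measurable_fun (@continuous_cos R).
have mi (D : set R) : measurable_fun D (fun x => Im (cexp (z * x%:C))).
  under eq_fun do rewrite zx /=.
  apply: measurable_funM; first exact: measurableT_comp.
  by apply: measurableT_comp => //; exact: continuous_measurable_fun (@continuous_sin R).
split.
- rewrite (_ : _ \o _ = fun x =>
    Re c * Re (cexp (z * x%:C)) - Im c * Im (cexp (z * x%:C))).
    by apply: measurable_funB; apply: measurable_funM.
  by apply/funext => x /=; rewrite ReM.
- rewrite (_ : _ \o _ = fun x =>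
    Re c * Im (cexp (z * x%:C)) + Im c * Re (cexp (z * x%:C))).
    by apply: measurable_funD; apply: measurable_funM.
  by apply/funext => x /=; rewrite ImM.
(* The modulus of [exp(zx)] is [expR (Re z * x)], and [|x| <= |a| + |b|] on the interval. *)
exists (normc c * expR (`|Re z| * (`|a| + `|b|))) => x.
rewrite /= in_itv /= => /andP[ax xb].
rewrite ComplexField.Normc.normcM normc_cexp ler_wpM2l ?normc_ge0// ler_expR zx /=.
apply: (le_trans (ler_norm _)); rewrite normrM ler_wpM2l// ler_norml.
have := ler_norm b; have := ler_norm (- a); rewrite normrN.
have := normr_ge0 a; have := normr_ge0 b => *; apply/andP; split; lra.
Qed.

(** Reducing [x] modulo 2 gives [r] in [0, 2[. Since [sin (r * pi)] is positive for [0 < r < 1] and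
    negative for [1 < r < 2], only [r = 0] and [r = 1] remain. *)
Lemma sin_mul_pi_eq0 x : sin (x * pi) = 0 -> exists m : int, x = m%:~R.
Proof.
pose n := Num.floor (x / 2); pose r := x - (2 * n)%:~R.
have /andP[r0 r2] : 0 <= r < 2.
  have /andP[] := floor_itv (x / 2); rewrite -/n /r => h1 h2.
  by move: h1 h2; rewrite intrD intrM => h1 h2; apply/andP; split; lra.
move=> sx; have : sin (r * pi) = 0.
  have [hc hs] := fourier_mode_pi (R := R) n.
  by rewrite /r mulrBl sinB sx hc hs mul0r mulr0 subrr.
have pi0 := @pi_gt0 R.
have xE : x = r + (2 * n)%:~R by rewrite /r subrK.
have [r1|r1|r1] := ltgtP r 1.
- have [r00|rn0] := eqVneq r 0.
    by move=> _; exists (2 * n); rewrite xE r00 add0r.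
  have : 0 < sin (r * pi).
    apply: sin_gt0_pi; rewrite gtr_pMl// r1 andbT mulr_gt0//.
    by rewrite lt_neqAle eq_sym rn0.
  by move=> + h; rewrite h ltxx.
- have : 0 < sin ((r - 1) * pi).
    by apply: sin_gt0_pi; rewrite gtr_pMl// mulr_gt0//=; lra.
  have -> : r * pi = (r - 1) * pi + pi by ring.
  by rewrite sinDpi => + /eqP; rewrite oppr_eq0 => /gt_eqF ->.
- by move=> _; exists (1 + 2 * n); rewrite xE r1 intrD.
Qed.

(** The sine of [s + it] has real part [cosh t sin s] and imaginary part [sinh t cos s]. If both
    vanish, then [sin s = 0], so [cos s] is nonzero and [t = 0]; thus [z] is real and in fact an
    integer. *)
Lemma csin_mul_pi_neq0 z : (forall m : int, z <> m%:~R) -> csin (z * pi%:C) != 0.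
Proof.
move=> zint; apply/eqP; rewrite csinE.
rewrite ReM ImM /= !mulr0 subr0 add0r.
move=> [+ +]; set t := Im z * pi; set s := Re z * pi => re0 im0.
have et := expR_gt0 t; have eNt := expR_gt0 (- t).
move/eqP: re0; rewrite mulf_eq0 => /orP[/eqP h|/eqP s0]; first by lra.
have c0 : cos s != 0.
  apply/eqP => c0; have := cos2Dsin2 s; rewrite s0 c0 expr0n /= addr0 => /eqP.
  by rewrite eq_sym oner_eq0.
move/eqP: im0; rewrite mulf_eq0 (negbTE c0) orbF => /eqP h.
have /expR_inj tt : expR t = expR (- t) by lra.
have /eqP : t = 0 by lra.
rewrite /t mulf_eq0 (gt_eqF (@pi_gt0 R)) orbF => /eqP im0.
have [m rm] := sin_mul_pi_eq0 s0.
apply: (zint m); rewrite -[RHS](rmorph_int (real_complex R)) -rm.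
by case: z im0 {zint rm s t et eNt s0 c0 h tt} => p q /= ->.
Qed.

End ComplexExponential.

(** * The operator carrying the exponentials to the sine system, and its inverse *)

Theorem lemmaA1 (R : realType) (alpha : R[i])
    (alpha_nint : forall m : int, alpha <> m%:~R) :
  riesz_basis (@L2_dot R 0 pi)
    (fun n : int => sin_L2 0 pi ((2 * n)%:~R + alpha)).
Proof.
have s0 := csin_mul_pi_neq0 alpha_nint; set s := csin _ in s0.
pose j : R[i] := 2 * 'i%C.
have j0 : j != 0 by rewrite mulf_neq0 ?pnatr_eq0// eq_complex /= oner_eq0 andbF.
pose r : R[i] := (Num.sqrt pi)%:C.
have r0 : r != 0.
  by rewrite -(rmorph0 (real_complex R)) (inj_eq (@complexI R)) sqrtr_eq0 -ltNge pi_gt0.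
pose z : R[i] := 'i%C * alpha.
pose u x := cexp (z * x%:C); pose v x := cexp ((- z) * x%:C).
have uv x : u x * v x = 1 by rewrite /u /v mulNr cexpN_mul.
have urefl x : u (0 + pi - x) = u pi * v x.
  by rewrite /u /v -cexpD add0r rmorphB; congr cexp; ring.
have vrefl x : v (0 + pi - x) = v pi * u x.
  by rewrite /u /v -cexpD add0r rmorphB; congr cexp; ring.
(* This is where [sin(pi alpha)] enters: [u pi - v pi = 2i sin(pi alpha)]. *)
have uvs : (u pi - v pi) / (s * j) = 1.
  rewrite (_ : u pi - v pi = s * j); first exact/mulfV/mulf_neq0.
  by rewrite /s /csin divfK// /u /v /z mulNr -mulrA.
have [T [bT TE]] := @reflected_multiplication_operator R 0 pi _ _
  (multiplier_cexp 0 pi (r / j) z) (multiplier_cexp 0 pi (- (r / j)) (- z)).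
(* If [g = T f], eliminating [f(pi - x)] from the equations at [x] and [pi - x] gives
   [u(pi) g(x) + g(pi - x) = r s u(x) f(x)]. Dividing, with [1 / u = v], yields the two
   coefficients. *)
have [S [bS SE]] := @reflected_multiplication_operator R 0 pi _ _
  (multiplier_cexp 0 pi (u pi / (r * s)) (- z)) (multiplier_cexp 0 pi (r * s)^-1 (- z)).
have rho2 x : 0 + pi - (0 + pi - x) = x :> R by ring.
exists fourier; first exact: fourier_basis.
exists T, S; split => //.
- apply: L2_ind => f; have [g gE ->] := TE f; have [h hE ->] := SE g.
  congr L2_class; apply: val_inj; apply/funext => x /=.
  rewrite hE !gE rho2 -!/(u _) -!/(v _) urefl vrefl.
  set p := f x; set q := f _.
  transitivity (p * (u x * v x) * ((u pi - v pi) / (s * j))).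
    by field; rewrite s0 j0 r0.
  by rewrite uv uvs !mulr1.
- apply: L2_ind => f; have [g gE ->] := SE f; have [h hE ->] := TE g.
  congr L2_class; apply: val_inj; apply/funext => x /=.
  rewrite hE !gE rho2 -!/(u _) -!/(v _) vrefl.
  set p := f x; set q := f _.
  (* In this order the reflected value [q] keeps the coefficient [1 - u pi * v pi], which vanishes
     only through the relation [uv] at [pi]. *)
  transitivity (p * (u x * v x) * ((u pi - v pi) / (s * j))
    + q * (u x * v x) * (1 - u pi * v pi) / (s * j)).
    by field; rewrite s0 j0 r0.
  by rewrite !uv uvs subrr mulr0 mul0r addr0 !mulr1.
- move=> n; have [g gE ->] := TE (SqFun (fourier_fun_sqint n)).
  congr L2_class; apply: val_inj; apply/funext => x /=.
  rewrite gE -!/(u _) -!/(v _) add0r.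
  change (r / j * u x * ((Num.sqrt pi)^-1%:C * fourier_mode n x)
    + - (r / j) * v x * ((Num.sqrt pi)^-1%:C * fourier_mode n (pi - x))
    = csin (((2 * n)%:~R + alpha) * x%:C)).
  have -> : (Num.sqrt pi)^-1%:C = r^-1 by rewrite fmorphV.
  rewrite fourier_mode_reflect /csin -/j.
  have -> : 'i%C * (((2 * n)%:~R + alpha) * x%:C)
    = 'i%C * ((2 * n)%:~R * x%:C) + z * x%:C by rewrite /z; ring.
  have -> : - ('i%C * ((2 * n)%:~R * x%:C) + z * x%:C)
    = 'i%C * ((2 * - n)%:~R * x%:C) + (- z) * x%:C.
    by rewrite mulrN rmorphN /=; ring.
  rewrite !cexpD !cexp_fourier_mode -/(u x) -/(v x).
  by field; rewrite r0 j0.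
Qed.
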